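(* Let $\lambda$ be any real number with $-2<\lambda<2$, and let $F:\mathbb{Z}^2\to\mathbb{Z}^2$ be the map $F(x,y)=(y,-\lfloor x+\lambda y\rfloor)$. Then $F$ has infinitely many periodic orbits on $\mathbb{Z}^2$.
   Context: Here $\lfloor\cdot\rfloor$ is the floor function. The map $F$ is a bijection of $\mathbb{Z}^2$. The orbit of $(x,y)\in\mathbb{Z}^2$ is $(F^n(x,y))_{n\in\mathbb{Z}}$. It is periodic if there is a positive integer $p$ with $F^p(x,y)=(x,y)$. Two points of $\mathbb{Z}^2$ lying on the same orbit (i.e. one is $F^n$ of the other for some $n\in\mathbb{Z}$) determine the same orbit, so the claim is that there are infinitely many pairwise distinct (disjoint) periodic orbits. *)

(* Defs.v *)
From mathcomp Require Import all_boot all_order all_algebra.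
From mathcomp Require Import all_classical all_reals.

Set Implicit Arguments.
Unset Strict Implicit.
Unset Printing Implicit Defensive.

Import Order.TTheory GRing.Theory Num.Theory.

Local Open Scope classical_set_scope.
Local Open Scope ring_scope.

Definition F (R : realType) (lam : R) (p : int * int) : int * int :=
  (p.2, - Num.floor (p.1%:~R + lam * p.2%:~R)).

Definition Finv (R : realType) (lam : R) (p : int * int) : int * int :=
  (- p.2 - Num.floor (lam * p.1%:~R), p.1).

Lemma FK (R : realType) (lam : R) : cancel (F lam) (Finv lam).
Proof.
case=> x y; rewrite /F /Finv /= opprK floorDzr ?intr_int//.
by rewrite intrKfloor addrK.
Qed.

Lemma FinvK (R : realType) (lam : R) : cancel (Finv lam) (F lam).
Proof.
case=> x y; rewrite /F /Finv /= floorDzr ?intr_int//.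
by rewrite intrKfloor subrK opprK.
Qed.

Lemma F_bij (R : realType) (lam : R) : bijective (F lam).
Proof. exact: Bijective (@FK R lam) (@FinvK R lam). Qed.

(* F^n for n : int; recall that [Negz m] is the integer -(m+1). *)
Definition Fiter (R : realType) (lam : R) (n : int) : int * int -> int * int :=
  match n with
  | Posz m => iter m (F lam)
  | Negz m => iter m.+1 (Finv lam)
  end.

(* The orbit (F^n p)_{n in Z} as a set of points, so that points on the same
   orbit determine equal orbits. *)
Definition Forbit (R : realType) (lam : R) (p : int * int) : set (int * int) :=
  range (fun n : int => Fiter lam n p).

Definition periodic (R : realType) (lam : R) (p : int * int) : Prop :=
  exists2 k : nat, (0 < k)%N & iter k (F lam) p = p.

Definition periodic_orbits (R : realType) (lam : R) : set (set (int * int)) :=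
  [set Forbit lam p | p in [set p | periodic lam p]].

(* Main.v *)
(* Write X = x - c, Y = y - c with c = 1/(2(2 + lam)). The quadratic form
   Q = X^2 + lam X Y + Y^2 changes along F by f (f - 2 u), where |f| <= 1/2 and
   u = X + lam Y / 2, so by at most w = |u| + 1/4. An aperiodic orbit leaves
   every disc Q <= r^2 in both directions, so the part of it in the disc that
   passes through a point p has total w-weight at least about 2 (r^2 - Q(p)).
   F is reversed by the swap (x, y) -> (y, x), so distinct aperiodic points p
   with swap p = p or swap p = F p lie on distinct orbits. Summed by rows, the
   w-weight of the disc is the sum over y of r^2 - s Y^2, with s = 1 - lam^2/4,
   up to O(r^2). At least half of the rows contain a point with swap p = F p, of
   energy s Y^2 + O(1); were these aperiodic up to finitely many, their orbits
   would already use up that weight, leaving only O(r^2) for the orbits of the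
   diagonal points, which need an amount of order r^3. *)

Require Import Defs.
From mathcomp Require Import all_boot all_order all_algebra.
From mathcomp Require Import all_classical all_reals.
From mathcomp Require Import zify ring lra.

Set Implicit Arguments.
Unset Strict Implicit.
Unset Printing Implicit Defensive.

Import Order.TTheory GRing.Theory Num.Theory.

Local Open Scope classical_set_scope.
Local Open Scope ring_scope.

(** * Energy and its change in one step *)

(* The translation by [center] makes the rounding error range over
   [-1/2, 1/2]. *)
Definition center (R : realType) (lam : R) : R := (2 * (2 + lam))^-1.

Definition drift (R : realType) (lam : R) (p : int * int) : R :=
  (p.1%:~R - center lam) + lam / 2 * (p.2%:~R - center lam).

(* This is X^2 + lam X Y + Y^2, with the square completed in X. *)
Definition energy (R : realType) (lam : R) (p : int * int) : R :=
  drift lam p ^+ 2 + (1 - lam ^+ 2 / 4) * (p.2%:~R - center lam) ^+ 2.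

Definition weight (R : realType) (lam : R) (p : int * int) : R :=
  `|drift lam p| + 1 / 4.

Definition swap (p : int * int) : int * int := (p.2, p.1).

Lemma energy_swap (R : realType) (lam : R) (p : int * int) :
  energy lam (swap p) = energy lam p.
Proof. by rewrite /energy /drift /swap /=; field. Qed.

Lemma center_mul (R : realType) (lam : R) (hl : -2 < lam) :
  center lam * (2 + lam) = 1 / 2.
Proof.
have h : 2 + lam != 0 by rewrite gt_eqF//; lra.
by rewrite /center; field.
Qed.

Lemma energy_ge0 (R : realType) (lam : R) (hl : -2 < lam) (hu : lam < 2)
  (p : int * int) : 0 <= energy lam p.
Proof.
rewrite /energy addr_ge0 ?sqr_ge0// mulr_ge0 ?sqr_ge0//; nra.
Qed.

Lemma energy_step (R : realType) (lam : R) (hl : -2 < lam) (p : int * int) :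
  `|energy lam (F lam p) - energy lam p| <= weight lam p.
Proof.
have /andP[f1 f2] := floor_itv (p.1%:~R + lam * p.2%:~R).
have hc := center_mul hl.
(* The fractional part minus 1/2; this offset equals [center lam * (2 + lam)], so the translation
   absorbs it. *)
pose f := p.1%:~R + lam * p.2%:~R
          - (Num.floor (p.1%:~R + lam * p.2%:~R))%:~R - 1 / 2.
have hf : `|f| <= 1 / 2.
  by rewrite ler_norml /f; move: f2; rewrite intrD => f2; apply/andP; split; lra.
have -> : energy lam (F lam p) - energy lam p = f * (f - 2 * drift lam p).
  rewrite /energy /drift /F /= mulrNz.
  have -> : (Num.floor (p.1%:~R + lam * p.2%:~R))%:~R = p.1%:~R + lam * p.2%:~R
          - f - center lam * (2 + lam) :> R by rewrite hc /f; ring.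
  by field.
rewrite normrM (le_trans (ler_wpM2r _ hf))//.
have := ler_normB f (2 * drift lam p); rewrite normrM (@ger0_norm _ 2)//.
by rewrite /weight; lra.
Qed.

(** * Reversibility and symmetric points *)

Lemma swap_F (R : realType) (lam : R) (p : int * int) :
  swap (F lam p) = Finv lam (swap p).
Proof.
case: p => x y; rewrite /swap /F /Finv /= floorDzr ?intr_int// intrKfloor.
by rewrite opprD.
Qed.

Lemma swap_iterF (R : realType) (lam : R) (n : nat) (p : int * int) :
  swap (iter n (F lam) p) = iter n (Finv lam) (swap p).
Proof. by elim: n => //= n <-; rewrite swap_F. Qed.

Lemma iter_FinvK (R : realType) (lam : R) (n : nat) :
  cancel (iter n (Finv lam)) (iter n (F lam)).
Proof.
by elim: n => // n IHn p; rewrite iterSr iterS FinvK IHn.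
Qed.

Lemma iterF_inj (R : realType) (lam : R) (n : nat) : injective (iter n (F lam)).
Proof.
elim: n => //= n IHn p q /(bij_inj (F_bij lam)); exact: IHn.
Qed.

Lemma iterF_aperiodic (R : realType) (lam : R) (p : int * int) (i j : nat) :
  ~ periodic lam p -> iter i (F lam) p = iter j (F lam) p -> i = j.
Proof.
wlog le_ij : i j / (i <= j)%N => [wl|] np eq_ij.
  by case: (leqP i j) => [/wl|/ltnW/wl]; [exact|move=> h; exact/esym/h].
apply/eqP; rewrite eqn_leq le_ij /= leqNgt; apply/negP => lt_ij; apply: np.
exists (j - i)%N; first by rewrite subn_gt0.
by apply: (@iterF_inj _ lam i); rewrite -iterD subnKC// eq_ij.
Qed.

(** [e = false] gives the points fixed by [swap], [e = true] those fixed by the second reversor,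
    [swap] after [F]. *)
Definition symmetric_point (R : realType) (lam : R) (p : int * int) :=
  exists e : bool, swap p = iter e (F lam) p.

(* Applying the reversor [swap] to F^i p = F^j q gives a second relation
   F^(j+d) p = F^(i+e) q between the same two orbits. *)
Lemma symmetric_orbit_inj (R : realType) (lam : R) (p q : int * int)
  (i j : nat) : ~ periodic lam p -> symmetric_point lam p ->
  symmetric_point lam q -> iter i (F lam) p = iter j (F lam) q -> p = q.
Proof.
move=> np [d hd] [e he] hij.
have hji : iter (j + d) (F lam) p = iter (i + e) (F lam) q.
  have /(congr1 swap) := hij; rewrite !swap_iterF hd he.
  move=> /(congr1 (iter (i + j) (F lam))).
  rewrite {1}[(i + j)%N]addnC [in LHS]iterD iter_FinvK -iterD => ->.
  by rewrite iterD iter_FinvK -iterD.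
have : iter (i + e + i) (F lam) p = iter (j + (j + d)) (F lam) p.
  rewrite iterD hij -iterD [RHS]iterD hji -iterD; congr iter; lia.
(* Aperiodicity turns this into 2i + e = 2j + d with d, e in {0, 1}, so parity forces i = j. *)
move=> /(iterF_aperiodic np) h.
have ij : i = j by case: d e h {hd he hji} => [] [] /= ; lia.
by move: hij; rewrite ij => /iterF_inj.
Qed.

(** * Boxes containing the energy discs *)

Lemma absz_le_real (R : realType) (x : int) (n : nat) :
  `|x%:~R : R| <= n%:R -> (`|x| <= n)%N.
Proof. by rewrite -intr_norm -abszE (pmulrn 1 n) ler_int lez_nat. Qed.

Lemma row_bound (R : realType) (lam : R) (hl : -2 < lam) (hu : lam < 2) :
  exists A : nat, forall (N : nat) (y : int), (0 < N)%N ->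
    (1 - lam ^+ 2 / 4) * (y%:~R - center lam) ^+ 2 <= (3 * N%:R) ^+ 2 ->
    (`|y| <= A * N)%N.
Proof.
pose s := 1 - lam ^+ 2 / 4; have s_gt0 : 0 < s by rewrite /s; nra.
have s_le1 : s <= 1 by rewrite /s; nra.
(* Since s <= 1, s Y^2 <= (3N)^2 gives Y^2 <= (3N / s)^2, so [B] needs no square root. *)
pose B := 3 / s; have Bs : B * s = 3 by rewrite divfK// gt_eqF.
have B0 : 0 < B by rewrite divr_gt0.
have B3 : 3 <= B by rewrite -Bs ger_pMr.
exists (Num.truncn (B + `|center lam|)).+1 => N y N_gt0; rewrite -/s => hy.
have N1 : (1 : R) <= N%:R by rewrite ler1n.
have N0 : (0 : R) <= N%:R by [].
apply: (@absz_le_real R); rewrite natrM.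
have hA := truncnS_gt (B + `|center lam|).
have hY : `|y%:~R - center lam| <= B * N%:R.
  rewrite -ler_sqr ?nnegrE ?normr_ge0 ?(mulr_ge0 (ltW B0))// real_normK ?num_real//.
  rewrite -(ler_pM2l s_gt0); apply: (le_trans hy).
  have -> : s * (B * N%:R) ^+ 2 = 3 * B * N%:R ^+ 2 by rewrite -Bs; ring.
  by rewrite exprMn ler_wpM2r ?sqr_ge0//; lra.
rewrite -[y%:~R](subrK (center lam)) (le_trans (ler_normD _ _))//.
have := ler_wpM2r N0 (ltW hA); rewrite mulrDl.
have : `|center lam| <= `|center lam| * N%:R by rewrite ler_peMr.
lra.
Qed.

Lemma row_le_energy (R : realType) (lam : R) (p : int * int) :
  (1 - lam ^+ 2 / 4) * (p.2%:~R - center lam) ^+ 2 <= energy lam p.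
Proof. by rewrite /energy lerDr sqr_ge0. Qed.

Definition zrange (M : nat) : seq int :=
  [seq i%:Z - M%:Z | i <- iota 0 (2 * M).+1].

Lemma zrange_uniq (M : nat) : uniq (zrange M).
Proof. by rewrite map_inj_uniq ?iota_uniq// => i j /addIr [->]. Qed.

Lemma mem_zrange (M : nat) (x : int) : (x \in zrange M) = (`|x| <= M)%N.
Proof.
apply/mapP/idP => [[i]|hx]; first by rewrite mem_iota => hi ->; lia.
by exists `|(x + M%:Z)%R|%N; rewrite ?mem_iota; lia.
Qed.

Lemma size_zrange (M : nat) : size (zrange M) = (2 * M).+1.
Proof. by rewrite size_map size_iota. Qed.

Definition box (M : nat) : seq (int * int) :=
  [seq (x, y) | y <- zrange M, x <- zrange M].

Lemma mem_box (M : nat) (p : int * int) :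
  (p \in box M) = (`|p.1| <= M)%N && (`|p.2| <= M)%N.
Proof.
case: p => x y /=; apply/allpairsP/andP => [[[y' x'] /= [hy hx [-> ->]]]|[hx hy]].
  by rewrite -!mem_zrange.
by exists (y, x); rewrite !mem_zrange.
Qed.

(** * Orbit segments inside a disc *)

(** Pigeonhole: the iterates of an aperiodic point are distinct, and the box is finite. *)
Lemma iterF_escape (R : realType) (lam r : R) (M : nat) (p : int * int) :
  (forall q, energy lam q <= r -> q \in box M) -> ~ periodic lam p ->
  exists n : nat, r < energy lam (iter n (F lam) p).
Proof.
move=> hM np; apply: contrapT => esc.
pose s := [seq iter n (F lam) p | n <- iota 0 (size (box M)).+1].
have s_uniq : uniq s.
  by rewrite map_inj_uniq ?iota_uniq// => i j /(iterF_aperiodic np).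
have : {subset s <= box M}.
  move=> _ /mapP[n _ ->]; apply: hM; rewrite leNgt; apply/negP => h.
  by apply: esc; exists n.
by move=> /(uniq_leq_size s_uniq); rewrite size_map size_iota ltnn.
Qed.

Lemma iterFinv_swap (R : realType) (lam : R) (n : nat) (p : int * int) :
  iter n (Finv lam) p = swap (iter n (F lam) (swap p)).
Proof. by rewrite swap_iterF; case: p. Qed.

Lemma aperiodic_swap (R : realType) (lam : R) (p : int * int) :
  ~ periodic lam p -> ~ periodic lam (swap p).
Proof.
move=> np [k k0 e]; apply: np; exists k => //.
by rewrite -[in LHS](_ : iter k (Finv lam) p = p) ?iter_FinvK// iterFinv_swap e; case: p {e}.
Qed.

Lemma weight_le (R : realType) (lam r : R) (hl : -2 < lam) (hu : lam < 2)
  (p : int * int) : 0 <= r -> energy lam p <= r ^+ 2 ->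
  weight lam p <= r + 1 / 4.
Proof.
move=> r0 hp; rewrite /weight lerD2r -ler_sqr ?nnegrE//.
rewrite real_normK ?num_real//; apply: le_trans hp; rewrite /energy lerDl.
by rewrite mulr_ge0 ?sqr_ge0//; nra.
Qed.

(** Take the iterates of [p] between its first exits from the disc in both time directions. On each
    side of [p] the energy differences telescope, and [energy_step] bounds each by a weight. If [p]
    lies outside the disc, the empty segment will do. *)
Lemma escaping_segment (R : realType) (lam r : R) (M : nat) (p : int * int) :
  -2 < lam -> lam < 2 -> 0 <= r ->
  (forall q, energy lam q <= r ^+ 2 -> q \in box M) -> ~ periodic lam p ->
  exists s : seq (int * int),
  [/\ uniq s,
      forall q, q \in s -> energy lam q <= r ^+ 2 /\
        exists i j : nat, iter i (F lam) q = iter j (F lam) p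
    & 2 * Num.max 0 (r ^+ 2 - energy lam p) - r - 1 / 4
      <= \sum_(q <- s) weight lam q].
Proof.
move=> hl hu r0 hM np; case: (leP (energy lam p) (r ^+ 2)) => hp; last first.
  by exists [::]; split; rewrite // big_nil max_l; lra.
have [n hn nmin] := ex_minnP (iterF_escape hM np).
have [m' hm mmin] := ex_minnP (iterF_escape hM (aperiodic_swap np)).
case: m' hm mmin => [|m] hm mmin; first by move: hm; rewrite /= energy_swap; lra.
(* The last point in the disc before the backward exit. *)
pose t := iter m (Finv lam) p.
have tp : iter m (F lam) t = p by rewrite iter_FinvK.
have nt : ~ periodic lam t.
  by move=> [k k0 e]; apply: np; exists k => //; rewrite -tp -iterD addnC iterD e.
have swapt k : (k <= m)%N -> iter k (F lam) t = iter (m - k) (Finv lam) p.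
  by move=> km; rewrite /t -{1}(subnKC km) iterD iter_FinvK.
have inball k : (k < m + n)%N -> energy lam (iter k (F lam) t) <= r ^+ 2.
  move=> kmn; rewrite leNgt; apply/negP; case: (leqP k m) => km.
    rewrite swapt// iterFinv_swap energy_swap => /mmin; lia.
  by rewrite -(subnK (ltnW km)) iterD tp => /nmin; lia.
exists [seq iter k (F lam) t | k <- iota 0 (m + n)]; split.
- by rewrite map_inj_uniq ?iota_uniq// => i j /(iterF_aperiodic nt).
- move=> q /mapP[k]; rewrite mem_iota => /andP[_ hk] ->; split; first exact: inball.
  by exists m, k; rewrite -iterD addnC iterD tp.
rewrite big_map iotaD big_cat /= -(addn0 (0 + m)%N) iotaDl big_map.
have fwd : r ^+ 2 - energy lam p <=
    \sum_(k <- iota 0 n) weight lam (iter (m + k) (F lam) t).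
  apply: (@le_trans _ _ (\sum_(0 <= k < n)
      (energy lam (iter k.+1 (F lam) p) - energy lam (iter k (F lam) p)))).
    by rewrite telescope_sumr// lerD2r ltW.
  rewrite /index_iota subn0; apply: ler_sum => k _.
  rewrite addnC iterD tp; apply: le_trans (energy_step hl _); exact: ler_norm.
have bwd : r ^+ 2 - r - 1 / 4 - energy lam p <=
    \sum_(k <- iota 0 m) weight lam (iter k (F lam) t).
  apply: (@le_trans _ _ (\sum_(0 <= k < m)
      (- energy lam (iter k.+1 (F lam) t) - (- energy lam (iter k (F lam) t))))).
    rewrite telescope_sumr// tp /=.
    (* [energy_step] at [swap t] compares [t] with its preimage outside the disc, so [energy lam t]
       exceeds r^2 - r - 1/4; this is the loss in the backward bound. *)
    have ht : energy lam (swap t) <= r ^+ 2.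
      rewrite energy_swap; case: (posnP (m + n)%N) => [|/inball//].
      by move=> /eqP; rewrite addn_eq0 => /andP[/eqP m0 _]; rewrite /t m0.
    move: hm; rewrite iterS -[iter m _ _](_ : swap t = _); last first.
      by rewrite /t iterFinv_swap; case: (iter _ _ _).
    have := le_trans (ler_norm _) (energy_step hl (swap t)).
    have := weight_le hl hu r0 ht.
    by rewrite !energy_swap; lra.
  rewrite /index_iota subn0; apply: ler_sum => k _.
  apply: le_trans (energy_step hl _); rewrite distrC opprK addrC; exact: ler_norm.
by rewrite max_r; lra.
Qed.

(** * The weight of a row *)

Lemma ler_sum_support (R : realType) (T : eqType) (s1 s2 : seq T) (h : T -> R) :
  uniq s1 -> (forall x, 0 <= h x) ->
  (forall x, x \in s1 -> h x != 0 -> x \in s2) ->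
  \sum_(x <- s1) h x <= \sum_(x <- s2) h x.
Proof.
move=> + h0; elim: s1 s2 => [|x s1 IH] s2 /=.
  by rewrite big_nil => *; apply: sumr_ge0.
move=> /andP[xs1 us1] sub; rewrite big_cons.
case: (eqVneq (h x) 0) => [->|hx].
  by rewrite add0r; apply: IH => // y ys1; apply: sub; rewrite inE ys1 orbT.
have xs2 : x \in s2 by apply: sub; rewrite ?mem_head.
rewrite (perm_big _ (perm_to_rem xs2)) big_cons lerD2l; apply: IH => // y ys1 hy.
have : y \in s2 by apply: sub; rewrite // inE ys1 orbT.
rewrite (perm_mem (perm_to_rem xs2)) inE => /orP[/eqP yx|//].
by move: xs1; rewrite -yx ys1.
Qed.

Lemma sum_half_row (R : realType) (d h : R) (n : nat) :
  0 <= d <= 1 -> 0 <= h ->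
  \sum_(k <- iota 0 n | d + k%:R <= h) (d + k%:R + 1 / 4)
  <= (h + 1) ^+ 2 / 2 + (h + 1) / 4.
Proof.
(* For the induction: m^2 / 2 + m / 4 grows by m + 3/4 when m grows by 1, which covers the added
   term. The cap h + 1 suffices because a term counts only while d + k <= h. *)
move=> /andP[d0 d1] h0; pose m k := Num.min (d + k%:R) (h + 1).
suff sum_le : \sum_(k <- iota 0 n | d + k%:R <= h) (d + k%:R + 1 / 4)
    <= m n ^+ 2 / 2 + m n / 4.
  apply: (le_trans sum_le); have : m n <= h + 1 by rewrite ge_min lexx orbT.
  have : 0 <= m n by rewrite le_min addr_ge0//; lra.
  nra.
elim: n => [|n IH].
  rewrite big_nil; have : 0 <= m 0%N by rewrite le_min addr_ge0//; lra.
  nra.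
have n0 : (0 : R) <= n%:R by [].
rewrite -addn1 iotaD big_cat big_cons big_nil addn1 /= add0n.
move: IH; rewrite /m -[n.+1]addn1 natrD.
case: ifP => [hn|/negbT]; last rewrite -ltNge => hn.
  by rewrite (min_l (_ : d + n%:R <= h + 1)) ?(min_l (_ : d + (n%:R + 1%:R) <= h + 1)); [nra|lra|lra].
rewrite addr0 (min_r (_ : h + 1 <= d + (n%:R + 1%:R))); last by lra.
move=> IH; apply: (le_trans IH).
have : Num.min (d + n%:R) (h + 1) <= h + 1 by rewrite ge_min lexx orbT.
have : 0 <= Num.min (d + n%:R) (h + 1) by rewrite le_min addr_ge0//; lra.
nra.
Qed.

Lemma sum_row (R : realType) (a h : R) (s : seq int) : uniq s -> 0 <= h ->
  \sum_(x <- s | `|x%:~R + a| <= h) (`|x%:~R + a| + 1 / 4)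
  <= h ^+ 2 + 5 / 2 * h + 3 / 2.
Proof.
move=> us h0; rewrite big_mkcond /=.
pose v (x : int) : R := if `|x%:~R + a| <= h then `|x%:~R + a| + 1 / 4 else 0.
rewrite -[leLHS]/(\sum_(x <- s) v x).
pose d := a - (Num.floor a)%:~R.
have /andP[d0 d1] : 0 <= d <= 1.
  by have := floor_itv a; rewrite intrD /d => /andP[? ?]; apply/andP; split; lra.
pose n := (Num.truncn h).+1; have hn : h < n%:R by exact: truncnS_gt.
(* To the right of -a the distances to -a are d, d + 1, ...; to the left they are 1 - d, 2 - d, ....
   The two half-row bounds add up to the claim. *)
pose s2 := [seq - Num.floor a + k%:Z | k <- iota 0 n]
  ++ [seq - Num.floor a - 1 - k%:Z | k <- iota 0 n].
have v0 x : 0 <= v x.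
  rewrite /v; case: ifP => // _; have := normr_ge0 (x%:~R + a); lra.
have up k : `|(- Num.floor a + k%:Z)%:~R + a| = d + k%:R :> R.
  have k0 : (0 : R) <= k%:R by [].
  have -> : (- Num.floor a + k%:Z)%:~R + a = d + k%:R by rewrite intrD mulrNz -pmulrn /d; ring.
  by rewrite ger0_norm; lra.
have dn k : `|(- Num.floor a - 1 - k%:Z)%:~R + a| = (1 - d) + k%:R :> R.
  have k0 : (0 : R) <= k%:R by [].
  have -> : (- Num.floor a - 1 - k%:Z)%:~R + a = - (1 - d + k%:R).
    by rewrite !intrD !mulrNz -pmulrn /d; ring.
  by rewrite normrN ger0_norm; lra.
have sub : \sum_(x <- s) v x <= \sum_(x <- s2) v x.
  apply: ler_sum_support => // x _; rewrite {1}/v; case: ifP => [|]; last by rewrite eqxx.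
  move=> hx _; rewrite mem_cat; apply/orP.
  case: (leP (- Num.floor a) x) => hxa; [left|right]; apply/mapP.
    pose k := `|(x + Num.floor a)%R|%N.
    have xk : x = - Num.floor a + k%:Z by rewrite /k; lia.
    exists k => //; rewrite mem_iota /= add0n -(ltr_nat R).
    by move: hx; rewrite xk up => hx; lra.
  pose k := `|(- Num.floor a - 1 - x)%R|%N.
  have xk : x = - Num.floor a - 1 - k%:Z by rewrite /k; lia.
  exists k => //; rewrite mem_iota /= add0n -(ltr_nat R).
  by move: hx; rewrite xk dn => hx; lra.
apply: (le_trans sub); rewrite big_cat !big_map /=.
have d01 : 0 <= d <= 1 by rewrite d0.
have d01' : 0 <= 1 - d <= 1 by apply/andP; split; lra.
have H1 := sum_half_row n d01 h0; have H2 := sum_half_row n d01' h0.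
rewrite big_mkcond in H1; rewrite big_mkcond in H2.
rewrite (eq_bigr (fun k : nat => if d + k%:R <= h then d + k%:R + 1 / 4 else 0)); last first.
  by move=> k _; rewrite /v up.
rewrite [X in _ + X](eq_bigr (fun k : nat => if 1 - d + k%:R <= h then 1 - d + k%:R + 1 / 4 else 0)); last first.
  by move=> k _; rewrite /v dn.
apply: (le_trans (lerD H1 H2)); lra.
Qed.

(** The squared half-length, measured in [drift], of the chord that row y cuts from the disc of
    radius r; it is 0 for a row that misses the disc. *)
Definition row_height (R : realType) (lam r : R) (y : int) : R :=
  Num.max 0 (r ^+ 2 - (1 - lam ^+ 2 / 4) * (y%:~R - center lam) ^+ 2).

Lemma row_height_ge0 (R : realType) (lam r : R) (y : int) :
  0 <= row_height lam r y.
Proof. by rewrite le_max lexx. Qed.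

Lemma sum_weight_row (R : realType) (lam r : R) (s : seq int) (y : int) :
  -2 < lam -> lam < 2 -> 0 <= r -> uniq s ->
  \sum_(x <- s | energy lam (x, y) <= r ^+ 2) weight lam (x, y)
  <= row_height lam r y + 5 / 2 * r + 3 / 2.
Proof.
move=> hl hu r0 us; pose h := Num.sqrt (row_height lam r y).
have h0 : 0 <= h by exact: sqrtr_ge0.
have h2 : h ^+ 2 = row_height lam r y by rewrite sqr_sqrtr ?row_height_ge0.
have s0 : 0 <= (1 - lam ^+ 2 / 4) * (y%:~R - center lam) ^+ 2.
  by rewrite mulr_ge0 ?sqr_ge0//; nra.
have hr : h <= r.
  by rewrite -ler_sqr ?nnegrE// h2 ge_max sqr_ge0 lerBlDr lerDl.
pose a := lam / 2 * (y%:~R - center lam) - center lam.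
have driftE (x : int) : drift lam (x, y) = x%:~R + a by rewrite /drift /a /=; ring.
apply: (@le_trans _ _ (\sum_(x <- s | `|x%:~R + a| <= h) (`|x%:~R + a| + 1 / 4))).
  rewrite big_mkcond [leRHS]big_mkcond; apply: ler_sum => x _.
  rewrite /weight driftE; case: ifP => hx; last first.
    case: ifP => // _; have := normr_ge0 (x%:~R + a); lra.
  rewrite ifT// -ler_sqr ?nnegrE// real_normK ?num_real// h2 le_max; apply/orP; right.
  by move: hx; rewrite /energy driftE /=; lra.
apply: (le_trans (sum_row _ us h0)); rewrite h2; lra.
Qed.

(** * Disjoint segments against the whole disc *)

(** Segments through different points of [L] cannot meet: a common point would put both on one
    orbit, against [symmetric_orbit_inj]. *)
Lemma disjoint_segments (R : realType) (lam r : R) (M : nat)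
  (L : seq (int * int)) :
  -2 < lam -> lam < 2 -> 0 <= r ->
  (forall q, energy lam q <= r ^+ 2 -> q \in box M) -> uniq L ->
  (forall p, p \in L -> symmetric_point lam p /\ ~ periodic lam p) ->
  exists s : seq (int * int),
  [/\ uniq s,
      forall q, q \in s -> energy lam q <= r ^+ 2 /\
        exists2 p, p \in L &
          exists i j : nat, iter i (F lam) q = iter j (F lam) p
    & \sum_(p <- L) (2 * Num.max 0 (r ^+ 2 - energy lam p) - r - 1 / 4)
      <= \sum_(q <- s) weight lam q].
Proof.
move=> hl hu r0 hM; elim: L => [|p L IH] /=.
  by exists [::]; split; rewrite ?big_nil.
move=> /andP[pL uL] sL.
have [|s [us hs sum_s]] := IH uL; first by move=> q qL; apply: sL; rewrite inE qL orbT.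
have [sp np] := sL _ (mem_head p L).
have [t [ut ht sum_t]] := escaping_segment hl hu r0 hM np.
exists (t ++ s); split; last by rewrite big_cat big_cons lerD.
- rewrite cat_uniq ut us andbT /=; apply/hasPn => q /hs[_ [p' p'L [i' [j' e']]]].
  apply/negP => /ht[_ [i [j e]]]; move: pL; rewrite (_ : p = p') ?p'L//.
  have [sp' _] : symmetric_point lam p' /\ ~ periodic lam p'.
    by apply: sL; rewrite inE p'L orbT.
  apply: (@symmetric_orbit_inj _ lam p p' (i' + j) (i + j')) => //.
  by rewrite !iterD -e -e' -!iterD addnC.
- move=> q; rewrite mem_cat => /orP[/ht[qr [i [j e]]]|/hs[qr [p' p'L e]]]; split=> //.
    by exists p; [exact: mem_head|exists i, j].
  by exists p' => //; rewrite inE p'L orbT.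
Qed.

(** The segments are disjoint and stay in the disc, so their total weight is at most that of the
    disc, which is summed row by row. *)
Lemma sum_symmetric_le (R : realType) (lam r : R) (M : nat)
  (L : seq (int * int)) :
  -2 < lam -> lam < 2 -> 0 <= r ->
  (forall q, energy lam q <= r ^+ 2 -> q \in box M) -> uniq L ->
  (forall p, p \in L -> symmetric_point lam p /\ ~ periodic lam p) ->
  \sum_(p <- L) (2 * Num.max 0 (r ^+ 2 - energy lam p) - r - 1 / 4)
  <= \sum_(y <- zrange M) (row_height lam r y + 5 / 2 * r + 3 / 2).
Proof.
move=> hl hu r0 hM uL sL.
have [s [us hs sum_s]] := disjoint_segments hl hu r0 hM uL sL.
apply: (le_trans sum_s).
pose v q := if energy lam q <= r ^+ 2 then weight lam q else 0.
have v0 q : 0 <= v q.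
  rewrite /v /weight; case: ifP => // _; have := normr_ge0 (drift lam q); lra.
apply: (@le_trans _ _ (\sum_(q <- box M) v q)).
  rewrite (eq_big_seq v) => [|q /hs[qr _]]; last by rewrite /v qr.
  by apply: ler_sum_support => // q /hs[qr _] _; exact: hM.
rewrite /box big_allpairs_dep; apply: ler_sum => y _.
rewrite -big_mkcond /=; exact: sum_weight_row (zrange_uniq M).
Qed.

(** * Points fixed by the second reversor *)

(* Row y contains a fixed point of the involution p -> swap (F p) iff the
   fractional part of lam y / 2 is less than 1/2. *)
Definition fixed_row (R : realType) (lam : R) (y : int) : bool :=
  lam * y%:~R / 2 - (Num.floor (lam * y%:~R / 2))%:~R < 1 / 2.

(** [swap p = F lam p] means 2x = - floor(lam y); this is its only possible solution in row y. *)
Definition fixed_point (R : realType) (lam : R) (y : int) : int * int :=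
  (- Num.floor (lam * y%:~R / 2), y).

Lemma fixed_rowP (R : realType) (lam : R) (y k : int) :
  k%:~R <= lam * y%:~R / 2 < k%:~R + 1 / 2 -> fixed_row lam y.
Proof.
move=> /andP[h1 h2]; rewrite /fixed_row (@floor_def _ _ k) ?ltrBlDl//.
by rewrite h1 intrD; lra.
Qed.

Lemma swap_fixed_point (R : realType) (lam : R) (y : int) :
  fixed_row lam y -> swap (fixed_point lam y) = F lam (fixed_point lam y).
Proof.
move=> hy; rewrite /swap /F /fixed_point /=; congr pair.
rewrite -[LHS]opprK; congr (- _); apply/esym/floor_def.
move: hy; rewrite /fixed_row mulrNz opprK intrD.
have := floor_le (lam * y%:~R / 2).
set fl := (Num.floor _)%:~R; move=> *; apply/andP; split; lra.
Qed.

(** The drift here is the fractional part of lam y / 2 minus 1/4, so in a fixed row its square is at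
    most 1/16. *)
Lemma row_height_fixed_point (R : realType) (lam r : R) (y : int) :
  -2 < lam -> fixed_row lam y ->
  row_height lam r y - 1 / 16
  <= Num.max 0 (r ^+ 2 - energy lam (fixed_point lam y)).
Proof.
move=> hl; rewrite /fixed_row /row_height /energy.
have hc := center_mul hl; have := floor_le (lam * y%:~R / 2).
have : drift lam (fixed_point lam y) =
    lam * y%:~R / 2 - (Num.floor (lam * y%:~R / 2))%:~R - 1 / 4.
  have -> : 1 / 4 = center lam * (2 + lam) / 2 :> R by rewrite hc; field.
  by rewrite /drift /fixed_point mulrNz /=; field.
rewrite /=; set u := drift _ _; set fl := (Num.floor _)%:~R => hu h1 h2.
have u2 : u ^+ 2 <= 1 / 16 by nra.
set b := _ * (_ - _) ^+ 2.
rewrite lerBlDr ge_max; apply/andP; split.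
  by have : 0 <= Num.max 0 (r ^+ 2 - (u ^+ 2 + b)) by [rewrite le_max lexx|]; lra.
have : r ^+ 2 - (u ^+ 2 + b) <= Num.max 0 (r ^+ 2 - (u ^+ 2 + b)).
  by rewrite le_max lexx orbT.
lra.
Qed.

(** Let s = 1 - lam^2 / 4 and Y = |y - c|. A row of positive height has s Y <= r, so moving at most
    D further out raises s Y^2 by at most 2 r D + D^2. *)
Lemma row_height_shift (R : realType) (lam r D : R) (y z : int) :
  -2 < lam -> lam < 2 -> 0 <= r -> 0 <= D ->
  `|z%:~R - center lam| <= `|y%:~R - center lam| + D ->
  row_height lam r y <= row_height lam r z + (2 * r * D + D ^+ 2).
Proof.
move=> hl hu r0 D0; rewrite /row_height.
rewrite -[(y%:~R - _) ^+ 2]real_normK ?num_real//.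
rewrite -[(z%:~R - _) ^+ 2]real_normK ?num_real//.
have := normr_ge0 (y%:~R - center lam); have := normr_ge0 (z%:~R - center lam).
set Y := `|y%:~R - _|; set Z := `|z%:~R - _| => Z0 Y0 hZ.
have s0 : 0 <= 1 - lam ^+ 2 / 4 by nra.
have s1 : 1 - lam ^+ 2 / 4 <= 1 by nra.
move: s0 s1; set s := 1 - _ => s0 s1.
have E0 : 0 <= 2 * r * D + D ^+ 2 by nra.
case: (leP (r ^+ 2 - s * Y ^+ 2) 0) => hY.
  by rewrite addr_ge0// le_max lexx.
have sY : s * Y <= r.
  rewrite -ler_sqr ?nnegrE ?mulr_ge0//; have : s ^+ 2 * Y ^+ 2 <= s * Y ^+ 2.
    by rewrite ler_wpM2r ?sqr_ge0//; nra.
  by rewrite exprMn; lra.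
have ZY : s * Z ^+ 2 <= s * (Y + D) ^+ 2.
  by rewrite ler_wpM2l// ler_sqr ?nnegrE ?addr_ge0.
have h1 : s * Y * D <= r * D by rewrite ler_wpM2r.
have h2 : s * D ^+ 2 <= D ^+ 2 by rewrite ler_piMl ?sqr_ge0.
have : r ^+ 2 - s * Z ^+ 2 <= Num.max 0 (r ^+ 2 - s * Z ^+ 2).
  by rewrite le_max lexx orbT.
have e : s * (Y + D) ^+ 2 = s * Y ^+ 2 + 2 * (s * Y * D) + s * D ^+ 2 by ring.
lra.
Qed.

(* If lam * y0 is an odd integer, the shift by y0 exchanges the rows that
   contain a fixed point with those that do not; otherwise one of the rows y
   and - y always contains one. *)
Lemma fixed_row_pairing (R : realType) (lam : R) :
  exists2 D : R, 0 <= D & exists t : int -> int, injective t /\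
    forall y, (fixed_row lam y || fixed_row lam (t y)) /\
      `|(t y)%:~R - center lam| <= `|y%:~R - center lam| + D.
Proof.
have [[y0 [k hk]]|none] :=
  pselect (exists y k : int, lam * y%:~R = (2 * k + 1)%:~R).
  exists `|y0%:~R|; first exact: normr_ge0.
  exists (fun y => y + y0); split; first exact: addIr.
  move=> y; split; last first.
    by rewrite intrD addrAC (le_trans (ler_normD _ _)).
  rewrite orbC; apply/orP; case: (boolP (fixed_row lam y)) => [|hy]; [by right|left].
  move: hy; rewrite /fixed_row -leNgt; set a := Num.floor _ => hy.
  (* Shifting by y0 adds k + 1/2 to lam y / 2; a fractional part of at least 1/2 then wraps to below
     1/2, so the floor rises by k + 1. *)
  apply: (@fixed_rowP _ _ _ (a + k + 1)).
  have := floorD1_gt (lam * y%:~R / 2); rewrite -/a !intrD mulrDr hk.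
  by rewrite intrD intrM; move=> h; apply/andP; split; lra.
exists (2 * `|center lam|); first by rewrite mulr_ge0.
exists -%R; split; first exact: oppr_inj.
move=> y; split; last first.
  rewrite mulrNz -opprD normrN.
  have -> : y%:~R + center lam = y%:~R - center lam + 2 * center lam by ring.
  by rewrite (le_trans (ler_normD _ _))// normrM (@ger0_norm _ 2).
apply/orP; case: (boolP (fixed_row lam y)) => [|hy]; [by left|right].
move: hy; rewrite /fixed_row -leNgt; set a := Num.floor _ => hy.
apply: (@fixed_rowP _ _ _ (- a - 1)).
have := floorD1_gt (lam * y%:~R / 2); rewrite -/a !intrD !mulrNz mulrN => h.
(* A fractional part of exactly 1/2 would make lam y the odd integer 2a + 1. One above 1/2 is sent
   below 1/2 by negation. *)
have ne : lam * y%:~R / 2 - a%:~R != 1 / 2.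
  apply/eqP => e; apply: none; exists y, a; rewrite intrD intrM; lra.
have : 1 / 2 < lam * y%:~R / 2 - a%:~R by rewrite lt_neqAle eq_sym ne hy.
by move=> h'; apply/andP; split; lra.
Qed.

Lemma sum_zrange_const (R : realType) (M : nat) (a : R) :
  \sum_(y <- zrange M) a = (2 * M%:R + 1) * a.
Proof.
rewrite big_const_seq count_predT size_zrange iter_addr addr0 -[LHS]mulr_natl.
by rewrite -addn1 natrD natrM.
Qed.

(** One of the rows y and [t y] is fixed, and its height bounds that of row y up to the shift error.
    As [t] is injective, the sum over the rows [t y] repeats no fixed row, whence the factor 2. *)
Lemma sum_row_height_fixed (R : realType) (lam : R) :
  -2 < lam -> lam < 2 -> exists2 D : R, 0 <= D & forall (r : R) (M : nat),
  0 <= r -> (forall y, row_height lam r y != 0 -> y \in zrange M) ->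
  \sum_(y <- zrange M) row_height lam r y
  <= 2 * (\sum_(y <- zrange M | fixed_row lam y) row_height lam r y)
     + (2 * M%:R + 1) * (2 * r * D + D ^+ 2).
Proof.
move=> hl hu; have [D D0 [t [t_inj ht]]] := fixed_row_pairing lam.
exists D => // r M r0 hM; pose E := 2 * r * D + D ^+ 2.
have E0 : 0 <= E by rewrite /E; nra.
pose g y := if fixed_row lam y then row_height lam r y else 0.
have g0 y : 0 <= g y by rewrite /g; case: ifP => // _; exact: row_height_ge0.
have step y : row_height lam r y <= g y + g (t y) + E.
  have [hg hd] := ht y; have := row_height_shift hl hu r0 D0 hd; rewrite -/E.
  have := g0 y; have := g0 (t y); have := row_height_ge0 lam r y; rewrite /g.
  by case/orP: hg => ->; case: ifP => _; lra.
have moved : \sum_(y <- zrange M) g (t y) <= \sum_(y <- zrange M) g y.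
  rewrite -(big_map t xpredT g); apply: ler_sum_support => //.
    by rewrite map_inj_uniq ?zrange_uniq.
  by move=> y _; rewrite /g; case: ifP => [_ /hM//|]; rewrite eqxx.
rewrite [X in 2 * X]big_mkcond -/g.
apply: (@le_trans _ _ (\sum_(y <- zrange M) (g y + g (t y) + E))); first exact: ler_sum.
rewrite big_split [X in X + _ <= _]big_split /= sum_zrange_const.
rewrite -[\sum_(y <- _) (if _ then _ else _)]/(\sum_(y <- zrange M) g y) -/E.
lra.
Qed.

(** * Discarding finitely many periodic points *)

Lemma sum_notin (R : realType) (T : eqType) (s P : seq T) (h : T -> R) (B : R) :
  uniq s -> 0 <= B -> (forall x, h x <= B) ->
  \sum_(x <- s) h x <= \sum_(x <- s | x \notin P) h x + (size P)%:R * B.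
Proof.
move=> us B0 hB; rewrite (bigID (mem P)) /= addrC lerD2l.
pose v x := if x \in P then B else 0.
apply: (@le_trans _ _ (\sum_(x <- s) v x)).
  by rewrite big_mkcond; apply: ler_sum => x _; rewrite /v; case: ifP.
apply: (@le_trans _ _ (\sum_(x <- P) v x)).
  apply: ler_sum_support => // x; rewrite /v; case: ifP => // _ _.
  by rewrite eqxx.
apply: (@le_trans _ _ (\sum_(x <- P) B)).
  by apply: ler_sum => x _; rewrite /v; case: ifP.
by rewrite big_const_seq count_predT iter_addr addr0 mulr_natl.
Qed.

Lemma iterFK (R : realType) (lam : R) (n : nat) :
  cancel (iter n (F lam)) (iter n (Finv lam)).
Proof.
by elim: n => // n IHn p; rewrite iterSr iterS FK IHn.
Qed.

Lemma Forbit_finite (R : realType) (lam : R) (p : int * int) :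
  periodic lam p -> finite_set (Forbit lam p).
Proof.
case=> k k0 e.
have ek m : iter (m * k) (F lam) p = p by elim: m => // m IH; rewrite mulSn iterD IH.
apply: (@sub_finite_set _ _ [set iter j (F lam) p | j in `I_k]).
  move=> q [n _ <-].
  have [j ->] : exists j, Fiter lam n p = iter j (F lam) p.
    case: n => n; first by exists n.
    (* F^k fixes p, so one backward step equals k - 1 forward steps. *)
    exists (n.+1 * k.-1)%N; rewrite /Fiter -[in LHS](ek n.+1).
    have -> : (n.+1 * k = n.+1 + n.+1 * k.-1)%N by rewrite -mulnS prednK.
    by rewrite iterD iterFK.
  exists (j %% k)%N; first by rewrite /= ltn_mod.
  by rewrite {2}(divn_eq j k) addnC iterD ek.
exact/finite_image/finite_II.
Qed.

Lemma periodic_finite (R : realType) (lam : R) :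
  finite_set (periodic_orbits lam) ->
  exists P : seq (int * int), forall p, periodic lam p -> p \in P.
Proof.
move=> fin; have /finite_seqP[P hP] : finite_set [set p | periodic lam p].
  apply: (@sub_finite_set _ _ (\bigcup_(O in periodic_orbits lam) O)).
    move=> p hp; exists (Forbit lam p); first by exists p.
    by exists 0.
  by apply: bigcup_finite => // _ [p hp <-]; exact: Forbit_finite.
by exists P => p hp; have : [set p | periodic lam p] p by []; rewrite hP.
Qed.

(** * Lower bounds from the symmetric points *)

Lemma diagonal_energy (R : realType) (lam : R) (N : nat) (i : nat) :
  -2 < lam -> lam < 2 -> center lam <= N%:R -> (i <= N)%N ->
  energy lam (i%:Z, i%:Z) <= 4 * N%:R ^+ 2.
Proof.
move=> hl hu hN iN.
have -> : energy lam (i%:Z, i%:Z) = (2 + lam) * (i%:R - center lam) ^+ 2.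
  by rewrite /energy /drift /= -pmulrn; field.
have c0 : 0 <= center lam by rewrite invr_ge0 mulr_ge0//; lra.
have i0 : (0 : R) <= i%:R by [].
have iNR : (i%:R : R) <= N%:R by rewrite ler_nat.
apply: ler_pM; rewrite ?sqr_ge0//; try lra.
nra.
Qed.

(** With r = 3N and diagonal energies at most 4 N^2, each point contributes at least 10 N^2 - 3N -
    1/4 >= 6 N^2. *)
Lemma sum_diagonal (R : realType) (lam : R) (N : nat) :
  -2 < lam -> lam < 2 -> (0 < N)%N -> center lam <= N%:R ->
  6 * N%:R ^+ 3 <= \sum_(p <- [seq (i%:Z, i%:Z) | i <- iota 1 N])
    (2 * Num.max 0 ((3 * N%:R) ^+ 2 - energy lam p) - 3 * N%:R - 1 / 4).
Proof.
move=> hl hu N0 hN; rewrite big_map.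
apply: (@le_trans _ _ (\sum_(i <- iota 1 N) 6 * N%:R ^+ 2)).
  by rewrite big_const_seq count_predT size_iota iter_addr addr0 -[leRHS]mulr_natl; lra.
rewrite big_seq [leRHS]big_seq; apply: ler_sum => i; rewrite mem_iota => /andP[_ iN].
have := diagonal_energy hl hu hN (_ : (i <= N)%N) => /(_ iN) h.
have N1 : (1 : R) <= N%:R by rewrite ler1n.
have : (3 * N%:R) ^+ 2 - energy lam (i%:Z, i%:Z)
    <= Num.max 0 ((3 * N%:R) ^+ 2 - energy lam (i%:Z, i%:Z)).
  by rewrite le_max lexx orbT.
have NN : (N%:R : R) <= N%:R ^+ 2 by nra.
nra.
Qed.

Lemma sum_fixed_points (R : realType) (lam r : R) (M : nat) :
  -2 < lam -> 0 <= r ->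
  2 * (\sum_(y <- zrange M | fixed_row lam y) row_height lam r y)
    - (2 * M%:R + 1) * (r + 3 / 8)
  <= \sum_(p <- [seq fixed_point lam y | y <- zrange M & fixed_row lam y])
    (2 * Num.max 0 (r ^+ 2 - energy lam p) - r - 1 / 4).
Proof.
(* The loss 3/8 is 1/4 plus twice the 1/16 of [row_height_fixed_point]. *)
move=> hl r0; rewrite [leRHS]big_map [leRHS]big_filter mulr_sumr.
apply: (@le_trans _ _ (\sum_(y <- zrange M | fixed_row lam y)
    (2 * row_height lam r y - (r + 3 / 8)))); last first.
  apply: ler_sum => y hy; have := row_height_fixed_point r hl hy; lra.
rewrite sumrB lerB// [leLHS]big_mkcond.
apply: (@le_trans _ _ (\sum_(y <- zrange M) (r + 3 / 8))).
  by apply: ler_sum => y _; case: ifP => // _; lra.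
by rewrite sum_zrange_const.
Qed.

(** * Comparing terms of order N^3 and N^2 *)

Theorem theorem1 (R : realType) (lam : R) (hl : -2 < lam) (hu : lam < 2) :
  infinite_set (periodic_orbits lam).
Proof.
move=> /periodic_finite[P hP].
have [A hA] := row_bound hl hu.
have [D D0 hD] := sum_row_height_fixed hl hu.
(* [K] collects the errors in units of N^2: at most (2A + 1) N rows, each losing at most (13 + 6D +
   D^2) N, and two lists, each losing at most 2 r^2 = 18 N^2 per point of [P]. *)
pose K := (2 * A%:R + 1) * (13 + 6 * D + D ^+ 2) + 36 * (size P)%:R.
have [N N0 hN] : exists2 N : nat, (0 < N)%N & `|K| + `|center lam| < N%:R.
  by exists (Num.truncn (`|K| + `|center lam|)).+1; [|exact: truncnS_gt].
have N1 : (1 : R) <= N%:R by rewrite ler1n.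
have NR0 : (0 : R) <= N%:R by [].
have cN : center lam <= N%:R.
  have := ler_norm (center lam); have := normr_ge0 K; lra.
have KN : K < N%:R by have := ler_norm K; have := normr_ge0 (center lam); lra.
pose r : R := 3 * N%:R; have r0 : 0 <= r by rewrite /r; lra.
pose M := (A * N)%N.
have hM q : energy lam q <= r ^+ 2 -> q \in box M.
  (* [hA] bounds y; applied to [swap q], which has the same energy, it bounds x. *)
  move=> hq; rewrite mem_box; apply/andP; split; apply: hA => //.
    by apply: le_trans (row_le_energy lam (swap q)) _; rewrite energy_swap.
  exact: le_trans (row_le_energy lam q) _.
have hrow y : row_height lam r y != 0 -> y \in zrange M.
  move=> hy; rewrite mem_zrange; apply: hA => //; rewrite leNgt; apply/negP => h.
  by move: hy; rewrite /row_height max_l ?eqxx// subr_le0 ltW.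
pose L1 := [seq (i%:Z, i%:Z) | i <- iota 1 N].
pose L2 := [seq fixed_point lam y | y <- zrange M & fixed_row lam y].
have uL1 : uniq L1 by rewrite map_inj_uniq ?iota_uniq// => i j [].
have uL2 : uniq L2 by rewrite map_inj_uniq ?filter_uniq ?zrange_uniq// => y z [].
pose L := [seq p <- L1 ++ L2 | p \notin P].
have sL1 p : p \in L1 -> swap p = p by move=> /mapP[i _ ->].
have sL2 p : p \in L2 -> swap p = F lam p.
  by move=> /mapP[y]; rewrite mem_filter => /andP[hy _] ->; exact: swap_fixed_point.
have uL : uniq L.
  rewrite /L filter_cat cat_uniq !filter_uniq// andbT; apply/hasPn => p.
  (* A point of both lists satisfies F p = swap p = p, so it is periodic and was removed with
     [P]. *)
  rewrite mem_filter => /andP[pP p2]; apply/negP => hp1.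
  move: (hp1 : p \in [seq q <- L1 | q \notin P]); rewrite mem_filter => /andP[_ p1].
  move: pP; rewrite hP//; exists 1%N => //=.
  by rewrite -sL2// sL1.
have sL p : p \in L -> symmetric_point lam p /\ ~ periodic lam p.
  rewrite mem_filter mem_cat => /andP[pP p12]; split.
    by case/orP: p12 => [/sL1|/sL2] h; [exists false|exists true].
  by move=> /hP; rewrite (negbTE pP).
pose v p := 2 * Num.max 0 (r ^+ 2 - energy lam p) - r - 1 / 4.
have vB p : v p <= 2 * r ^+ 2.
  have : Num.max 0 (r ^+ 2 - energy lam p) <= r ^+ 2.
    by rewrite ge_max sqr_ge0 lerBlDr lerDl energy_ge0.
  by rewrite /v; lra.
have B0 : 0 <= 2 * r ^+ 2 by rewrite mulr_ge0 ?sqr_ge0.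
have S1 := sum_notin P uL1 B0 vB; have S2 := sum_notin P uL2 B0 vB.
have H : \sum_(p <- L) v p
    <= \sum_(y <- zrange M) (row_height lam r y + 5 / 2 * r + 3 / 2).
  exact: sum_symmetric_le.
rewrite big_filter big_cat 2![in leRHS]big_split !sum_zrange_const /= in H.
have D1 : 6 * N%:R ^+ 3 <= \sum_(p <- L1) v p by exact: sum_diagonal.
have D2 := sum_fixed_points M hl r0; rewrite -[X in _ <= X]/(\sum_(p <- L2) v p) in D2.
have D3 := hD r M r0 hrow.
have Mbound : 2 * M%:R + 1 <= (2 * A%:R + 1) * N%:R :> R.
  by rewrite /M natrM; have : (0 : R) <= A%:R by []; nra.
have Ebound : 7 / 2 * r + 15 / 8 + (2 * r * D + D ^+ 2)
    <= (13 + 6 * D + D ^+ 2) * N%:R.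
  have : D ^+ 2 <= D ^+ 2 * N%:R by rewrite ler_peMr ?sqr_ge0.
  rewrite /r; lra.
have M0 : (0 : R) <= M%:R by [].
have prod : (2 * M%:R + 1) * (7 / 2 * r + 15 / 8 + (2 * r * D + D ^+ 2))
    <= (2 * A%:R + 1) * N%:R * ((13 + 6 * D + D ^+ 2) * N%:R).
  by apply: ler_pM => //; nra.
(* By [D2] and [D3], [L2] uses up the row heights on the right of [H] up to errors; what remains for
   [L1] is at most K N^2. *)
have : 6 * N%:R ^+ 3 <= K * N%:R ^+ 2.
  have -> : K * N%:R ^+ 2 = (2 * A%:R + 1) * N%:R * ((13 + 6 * D + D ^+ 2) * N%:R)
      + (size P)%:R * (4 * r ^+ 2) by rewrite /K /r; ring.
  lra.
have N2 : 0 < N%:R ^+ 2 :> R by rewrite exprn_gt0//; lra.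
rewrite exprS mulrA ler_pM2r//; lra.
Qed.
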